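(* Let $\Omega\subset\widehat\Omega$ be finite sets. Let $K$ be a $\frac12$-lazy, ergodic, irreducible, reversible Markov kernel on $\widehat\Omega$ with stationary distribution $\mu$, and let $Q$ be a $\frac12$-lazy, ergodic, irreducible, reversible Markov kernel on $\Omega$ with stationary distribution $\nu$. Let $\widehat E=\{(x,y)\in\widehat\Omega^2: K(x,y)>0\}$ and $E=\{(x,y)\in\Omega^2:Q(x,y)>0\}$. Fix probability measures $\{P_x\}_{x\in\widehat\Omega}$ on $\Omega$ with $P_x=\delta_x$ for $x\in\Omega$, couplings $\{P_{x,y}\}_{(x,y)\in\widehat E}$ of $P_x$ and $P_y$, and a flow $F$ (as defined in the context). Then for every $f:\Omega\to\mathbb{R}$, the extension $\widehat f(x)=\sum_{y\in\Omega}P_x[y]f(y)$, $x\in\widehat\Omega$, satisfies $$\mathcal{E}_K(\widehat f,\widehat f)\le\mathcal{A}\,\mathcal{E}_Q(f,f),$$ where $$\begin{aligned}\mathcal{A}=\sup_{Q(q,r)>0}\frac{1}{Q(q,r)\nu(q)}\Big(&\sum_{\gamma\ni(q,r)}F[\gamma]k[\gamma]K(i(\gamma),o(\gamma))\mu(i(\gamma))\\&+2\sum_{\gamma\ni(q,r)}k[\gamma]F[\gamma]\sum_{y\in\widehat\Omega\setminus\Omega}P_y[o(\gamma)]K(i(\gamma),y)\mu(i(\gamma))\\&+\sum_{\gamma\ni(q,r)}F[\gamma]k[\gamma]\sum_{(x,y)\in\widehat E,\;x,y\notin\Omega}P_{x,y}[i(\gamma),o(\gamma)]K(x,y)\mu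(x)\Big).\end{aligned}$$
   Context: A kernel $P$ is $\frac12$-lazy if $P(x,x)\ge\frac12$ for all $x$. For a kernel $P$ on a finite set $X$ with stationary distribution $\pi$, $\mathcal{E}_P(f,f)=\frac12\sum_{x,y\in X}|f(x)-f(y)|^2P(x,y)\pi(x)$. Couplings: for each $(x,y)\in\widehat E$, $P_{x,y}$ is a probability measure on $\Omega\times\Omega$ with $\sum_bP_{x,y}[a,b]=P_x[a]$ for all $a\in\Omega$ and $\sum_aP_{x,y}[a,b]=P_y[b]$ for all $b\in\Omega$. A path from $a$ to $b$ is a finite sequence $\gamma=(a=v_0,v_1,\dots,v_{k[\gamma]}=b)$ of elements of $\Omega$ with $(v_i,v_{i+1})\in E$ for $0\le i<k[\gamma]$; $k[\gamma]$ is its length, $i(\gamma)=a$ its initial vertex, $o(\gamma)=b$ its final vertex. $\Gamma_{a,b}$ is the set of all paths from $a$ to $b$. A flow is a function $F$ from paths to $[0,1]$ with $\sum_{\gamma\in\Gamma_{a,b}}F[\gamma]=1$ for all $a,b\in\Omega$. The notation $\gamma\ni(q,r)$ means that $(v_i,v_{i+1})=(q,r)$ for some $0\le i<k[\gamma]$; the sums over $\gamma\ni(q,r)$ run over all such paths. *)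

(* Defs.v *)
From HB Require Import structures.
From mathcomp Require Import all_boot all_order all_algebra.
From mathcomp Require Import all_classical all_reals all_analysis.

Set Implicit Arguments.
Unset Strict Implicit.
Unset Printing Implicit Defensive.

Import Order.TTheory GRing.Theory Num.Theory.
Import numFieldNormedType.Exports.

Local Open Scope classical_set_scope.
Local Open Scope ring_scope.

Section Kernels.
Variables (R : realType) (V : finType).
Implicit Types (p : V -> R) (K : V -> V -> R).

Definition prob_measure p : Prop :=
  (forall x, 0 <= p x) /\ \sum_x p x = 1.

Definition markov_kernel K : Prop := forall x, prob_measure (K x).

Fixpoint kernel_pow K (n : nat) (x y : V) : R :=
  if n is n'.+1 then \sum_z K x z * kernel_pow K n' z y else (x == y)%:R.

Definition half_lazy K : Prop := forall x, 2^-1 <= K x x.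

Definition stationary K p : Prop :=
  prob_measure p /\ forall y, \sum_x p x * K x y = p y.

Definition reversible K p : Prop := forall x y, p x * K x y = p y * K y x.

Definition irreducible K : Prop :=
  forall x y, exists n, 0 < kernel_pow K n x y.

(* Convergence to p from every starting state; this does not include
   irreducibility, since transient states are allowed. *)
Definition ergodic K p : Prop :=
  forall x y, (fun n => kernel_pow K n x y) @ \oo --> p y.

Definition dirichlet K p (f : V -> R) : R :=
  2^-1 * \sum_x \sum_y `|f x - f y| ^+ 2 * K x y * p x.

End Kernels.

Definition coupling (R : realType) (V : finType) (p p' : V -> R) (c : V -> V -> R) : Prop :=
  [/\ prob_measure (fun ab : V * V => c ab.1 ab.2),
      forall a, \sum_b c a b = p a
    & forall b, \sum_a c a b = p' b].

Section Flows.
Variables (R : realType) (V : finType) (Q : V -> V -> R).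

(* The pair (v0, [:: v1; ...; vk]) encodes the vertex sequence v0, ..., vk;
   k = 0 is allowed. *)
Definition vseq : Type := (V * seq V)%type.
HB.instance Definition _ := Choice.on vseq.

Implicit Types g : vseq.

Definition is_path g : Prop := path (fun q r => 0 < Q q r) g.1 g.2.
Definition path_length g : nat := size g.2.
Definition path_init g : V := g.1.
Definition path_final g : V := last g.1 g.2.
Definition path_vertex g (i : nat) : V := nth g.1 (g.1 :: g.2) i.

Definition paths_between (a b : V) : set vseq :=
  [set g | [/\ is_path g, path_init g = a & path_final g = b]].

(* A set of paths: a path using (q, r) several times is counted once. *)
Definition paths_through (q r : V) : set vseq :=
  [set g | is_path g /\ exists i, [/\ (i < path_length g)%N,
     path_vertex g i = q & path_vertex g i.+1 = r]].

(* Values of F off the paths are irrelevant. *)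
Definition is_flow (F : vseq -> R) : Prop :=
  (forall g, is_path g -> 0 <= F g <= 1) /\
  (forall a b, \esum_(g in paths_between a b) (F g)%:E = 1%E).

End Flows.

Arguments vseq V : clear implicits.

Section Comparison.
Variables (R : realType) (T : finType) (Om : {set T}).

Local Notation V := {x : T | x \in Om}.

Definition extension (P : T -> V -> R) (f : V -> R) (x : T) : R :=
  \sum_y P x y * f y.

Variables (K : T -> T -> R) (mu : T -> R) (Q : V -> V -> R) (nu : V -> R).
Variables (P : T -> V -> R) (C : T -> T -> V -> V -> R) (F : vseq V -> R).

Local Open Scope ereal_scope.

Definition congestion (q r : V) : \bar R :=
  ((Q q r * nu q)^-1)%:E *
  ((\esum_(g in paths_through Q q r)
      (F g * (path_length g)%:R
       * K (val (path_init g)) (val (path_final g))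
       * mu (val (path_init g)))%:E)
   + 2%:E * (\esum_(g in paths_through Q q r)
      ((path_length g)%:R * F g
       * \sum_(y | y \notin Om)
           P y (path_final g) * K (val (path_init g)) y
           * mu (val (path_init g)))%:E)
   + (\esum_(g in paths_through Q q r)
      (F g * (path_length g)%:R
       * \sum_(xy : T * T | [&& (0 < K xy.1 xy.2)%R,
                                xy.1 \notin Om & xy.2 \notin Om])
           C xy.1 xy.2 (path_init g) (path_final g)
           * K xy.1 xy.2 * mu xy.1)%:E)).

(* The sum over paths may be infinite, so the constant lies in [0, +oo]. *)
Definition comparison_const : \bar R :=
  ereal_sup [set congestion qr.1 qr.2 | qr in
               [set qr : V * V | (0 < Q qr.1 qr.2)%R]].

End Comparison.

(* Main.v *)
(* Jensen's inequality along the couplings bounds E_K(f^, f^) by the Dirichlet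
   form of a weight W on pairs of points of Om.  The flow F averages each
   (f a - f b)^2 over the paths from a to b, where Cauchy-Schwarz bounds it by the
   length of the path times the sum of (f q - f r)^2 over its edges; exchanging
   the two sums produces the congestion of each edge. *)

Require Import Defs.
From HB Require Import structures.
From mathcomp Require Import all_boot all_order all_algebra.
From mathcomp Require Import all_classical all_reals all_analysis.
From mathcomp Require Import ring lra.

Set Implicit Arguments.
Unset Strict Implicit.
Unset Printing Implicit Defensive.

Import Order.TTheory GRing.Theory Num.Theory.
Import numFieldNormedType.Exports.

Local Open Scope classical_set_scope.
Local Open Scope ring_scope.

(** * Cauchy-Schwarz inequalities for finite weighted sums *)

Lemma sqr_sum_le (R : realFieldType) (I : Type) (r : seq I) (w x : I -> R) :
  (forall i, 0 <= w i) ->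
  (\sum_(i <- r) w i * x i) ^+ 2
    <= (\sum_(i <- r) w i) * \sum_(i <- r) w i * x i ^+ 2.
Proof.
move=> w0; elim: r => [|i r]; first by rewrite !big_nil expr0n mul0r.
rewrite !big_cons.
have W0 : 0 <= \sum_(j <- r) w j by exact: sumr_ge0.
have S0 : 0 <= \sum_(j <- r) w j * x j ^+ 2.
  by apply: sumr_ge0 => j _; rewrite mulr_ge0 ?sqr_ge0.
move: (\sum_(j <- r) w j) (\sum_(j <- r) w j * x j)
  (\sum_(j <- r) w j * x j ^+ 2) W0 S0 => W s S W0 S0 IH.
(* Expanding the squares, only the cross term is not covered by [IH : s ^+ 2 <= W * S]. If [W = 0],
   then [IH] forces [s = 0]; otherwise multiply by [W] and use [(s - W * x i) ^+ 2 >= 0]. *)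
suff h : 2 * x i * s <= S + W * x i ^+ 2.
  by have := w0 i; nra.
move: W0; rewrite le_eqVlt => /predU1P[W0|W0].
  have s0 : s = 0.
    by apply/eqP; rewrite -sqrf_eq0 eq_le sqr_ge0 andbT (le_trans IH)// -W0 mul0r.
  by rewrite s0 -W0; lra.
rewrite -(ler_pM2l W0).
have := sqr_ge0 (s - W * x i); nra.
Qed.

Lemma sqr_sum_size_le (R : realFieldType) (I : Type) (r : seq I) (x : I -> R) :
  (\sum_(i <- r) x i) ^+ 2 <= (size r)%:R * \sum_(i <- r) x i ^+ 2.
Proof.
have := @sqr_sum_le R I r (fun=> 1) x (fun=> ler01).
rewrite big_const_seq count_predT iter_addr_0.
by under eq_bigr do rewrite mul1r; under [X in _ * X]eq_bigr do rewrite mul1r.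
Qed.

(** * Telescoping along loop-erased paths *)

Section Paths.
Variables (R : realFieldType) (V : finType).

Lemma telescope_path (f : V -> R) (x : V) (s : seq V) :
  f x - f (last x s) = \sum_(e <- zip (x :: s) s) (f e.1 - f e.2).
Proof.
elim: s x => [|y s IH] x; first by rewrite big_nil subrr.
by rewrite big_cons -IH /= addrA subrK.
Qed.

Lemma size_zip_path (x : V) (s : seq V) : size (zip (x :: s) s) = size s.
Proof. by rewrite size_zip /= (minn_idPr _). Qed.

Lemma path_zip (e : rel V) (x : V) (s : seq V) :
  path e x s = all (fun qr => e qr.1 qr.2) (zip (x :: s) s).
Proof. by elim: s x => [//|y s IH] x /=; rewrite IH. Qed.

(* An edge repeated along the path counts only once on the right-hand side, so
   the loops of the path are erased before telescoping. *)
Lemma sqr_path_le (f : V -> R) (x : V) (s : seq V) (A : pred (V * V)) :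
  {subset zip (x :: s) s <= A} ->
  (f x - f (last x s)) ^+ 2
    <= (size s)%:R * \sum_(e | A e) (f e.1 - f e.2) ^+ 2.
Proof.
move=> sA; pose E := fun q r => A (q, r).
have : path E x s by rewrite path_zip; apply/allP => -[q r] /sA.
case/shortenP => s' pE us' ss'.
rewrite telescope_path (le_trans (sqr_sum_size_le _ _))// size_zip_path.
apply: ler_pM => //; first by apply: sumr_ge0 => e _; exact: sqr_ge0.
  by rewrite ler_nat uniq_leq_size// ; case/andP: us'.
(* The vertices of [s'] are distinct and an edge is determined by its position as a target there, so
   no edge repeats. *)
have ue : uniq (zip (x :: s') s').
  by rewrite (@map_uniq _ _ snd)// -/(unzip2 _) unzip2_zip//=; case/andP: us'.
rewrite big_uniq//= [leRHS](bigID (mem (zip (x :: s') s')))/=.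
rewrite -[leLHS]addr0 lerD//; last by apply: sumr_ge0 => e _; exact: sqr_ge0.
rewrite le_eqVlt; apply/orP; left; apply/eqP/eq_bigl => -[q r].
case: (boolP (_ \in _)) => [qr|]; last by rewrite andbF.
by move: pE; rewrite path_zip => /allP/(_ _ qr); rewrite andbT => /esym.
Qed.

End Paths.

Lemma ge0_esumZl (R : realType) (I : choiceType) (D : set I) (c : R)
    (a : I -> \bar R) : 0 <= c -> (forall i, D i -> (0 <= a i)%E) ->
  (\esum_(i in D) (c%:E * a i) = c%:E * \esum_(i in D) a i)%E.
Proof.
move=> c0 a0; rewrite /esum -ereal_supZl//; last first.
  (* The empty sum shows that the set of finite partial sums is nonempty, as needed to move [c]
     across the supremum. *)
  by apply/set0P; exists (\sum_(i \in set0) a i)%E, set0 => //; exact: fsets_set0.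
congr ereal_sup; rewrite image_comp; apply: eq_imagel => A [finA AD] /=.
rewrite !fsbig_finite//= big_seq [in RHS]big_seq ge0_sume_distrr// => i.
by rewrite in_fset_set// inE => /AD/a0.
Qed.

(** * Positivity of stationary distributions *)

Lemma stationary_kernel_pow (R : realType) (V : finType) (K : V -> V -> R)
    (p : V -> R) (n : nat) :
  stationary K p -> forall y, \sum_x p x * kernel_pow K n x y = p y.
Proof.
move=> [_ st]; elim: n => [|n IH] y /=.
  rewrite (bigD1 y)//= eqxx mulr1 big1 ?addr0// => x /negbTE ->.
  by rewrite mulr0.
rewrite -IH; under eq_bigr do rewrite big_distrr/=.
rewrite exchange_big/=; apply: eq_bigr => z _.
by rewrite -st big_distrl/=; apply: eq_bigr => x _; rewrite mulrA.
Qed.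

Lemma kernel_pow_ge0 (R : realType) (V : finType) (K : V -> V -> R) (n : nat) :
  markov_kernel K -> forall x y, 0 <= kernel_pow K n x y.
Proof.
move=> mK; elim: n => [|n IH] x y /=; first exact: ler0n.
by apply: sumr_ge0 => z _; rewrite mulr_ge0//; case: (mK x).
Qed.

(** Some state [x] carries mass, and irreducibility sends part of it to [y] in [n] steps;
    stationarity under the [n]-step kernel makes this part a lower bound for [p y]. *)
Lemma stationary_gt0 (R : realType) (V : finType) (K : V -> V -> R) (p : V -> R) :
  markov_kernel K -> irreducible K -> stationary K p -> forall y, 0 < p y.
Proof.
move=> mK irr st y; have [[p0 p1] _] := st.
have [x px] : exists x, 0 < p x.
  apply/not_existsP => h; suff : \sum_x p x = 0 by rewrite p1; apply/eqP/oner_neq0.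
  by apply: big1 => x _; apply/eqP; rewrite eq_le p0 leNgt andbT; apply/negP/h.
have [n K0] := irr x y.
rewrite -(stationary_kernel_pow n st y) (bigD1 x)//=.
rewrite ltr_pwDl// ?mulr_gt0// sumr_ge0// => z _.
by rewrite mulr_ge0// kernel_pow_ge0.
Qed.

Lemma sqr_mean_le (R : realFieldType) (V : finType) (p : V -> R) (x : V -> R) :
  (forall i, 0 <= p i) -> \sum_i p i = 1 ->
  (\sum_i p i * x i) ^+ 2 <= \sum_i p i * x i ^+ 2.
Proof. by move=> p0 p1; rewrite -[leRHS]mul1r -p1 sqr_sum_le. Qed.

(** * The Dirichlet form of the extended function *)

Section DirichletExtension.
Variables (R : realType) (T : finType) (Om : {set T}).
Local Notation V := {x : T | x \in Om}.
Variables (K : T -> T -> R) (mu : T -> R).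
Variables (P : T -> V -> R) (C : T -> T -> V -> V -> R).
Hypothesis P_prob : forall x, prob_measure (P x).
Hypothesis P_delta : forall x y : V, P (val x) y = (y == x)%:R.

Lemma extension_val (f : V -> R) (x : V) : extension P f (val x) = f x.
Proof.
rewrite /extension (bigD1 x)//= P_delta eqxx mul1r big1 ?addr0// => y /negbTE yx.
by rewrite P_delta yx mul0r.
Qed.

(** Serves the transitions across the boundary: at a point of [Om] the measure is a point mass, so
    Jensen under [P y] alone suffices. *)
Lemma sqr_extension_le (f : V -> R) (x : V) (y : T) :
  (f x - extension P f y) ^+ 2 <= \sum_b P y b * (f x - f b) ^+ 2.
Proof.
have [P0 P1] := P_prob y.
have -> : f x - extension P f y = \sum_b P y b * (f x - f b).
  under eq_bigr do rewrite mulrBr.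
  by rewrite sumrB -big_distrl/= P1 mul1r.
exact: sqr_mean_le.
Qed.

(** The marginals turn the difference of the two means into one mean of [f a - f b] over pairs, to
    which Jensen applies. *)
Lemma sqr_coupling_le (f : V -> R) (x y : T) : coupling (P x) (P y) (C x y) ->
  (extension P f x - extension P f y) ^+ 2
    <= \sum_a \sum_b C x y a b * (f a - f b) ^+ 2.
Proof.
move=> [[C0 C1] Cl Cr].
have -> : extension P f x - extension P f y
    = \sum_(ab : V * V) C x y ab.1 ab.2 * (f ab.1 - f ab.2).
  under eq_bigr do rewrite mulrBr.
  rewrite sumrB -(pair_bigA _ (fun a b => C x y a b * f a))/=.
  rewrite -(pair_bigA _ (fun a b => C x y a b * f b))/= [X in _ = _ - X]exchange_big/=.
  congr (_ - _); rewrite /extension; apply: eq_bigr => a _;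
    by rewrite -big_distrl/= ?Cl ?Cr.
by rewrite pair_bigA; exact: sqr_mean_le.
Qed.

Hypothesis K_markov : markov_kernel K.
Hypothesis K_rev : reversible K mu.
Hypothesis mu_ge0 : forall x, 0 <= mu x.
Hypothesis C_coupling :
  forall x y : T, 0 < K x y -> coupling (P x) (P y) (C x y).

(* The three summands are the transitions of K inside Om, across its boundary,
   and outside it, the last two transported to Om by P and C. *)
Definition transported (a b : V) : R :=
  K (val a) (val b) * mu (val a)
  + 2 * \sum_(y | y \notin Om) P y b * K (val a) y * mu (val a)
  + \sum_(xy : T * T | [&& 0 < K xy.1 xy.2, xy.1 \notin Om & xy.2 \notin Om])
      C xy.1 xy.2 a b * K xy.1 xy.2 * mu xy.1.

Lemma boundary_ge0 (a b : V) :
  0 <= \sum_(y | y \notin Om) P y b * K (val a) y * mu (val a).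
Proof.
apply: sumr_ge0 => y _; have [P0 _] := P_prob y; have [K0 _] := K_markov (val a).
by rewrite !mulr_ge0.
Qed.

Lemma exterior_ge0 (a b : V) :
  0 <= \sum_(xy : T * T | [&& 0 < K xy.1 xy.2, xy.1 \notin Om & xy.2 \notin Om])
      C xy.1 xy.2 a b * K xy.1 xy.2 * mu xy.1.
Proof.
apply: sumr_ge0 => -[x y] /= /and3P[Kxy _ _].
have [[C0 _] _ _] := C_coupling Kxy.
by rewrite !mulr_ge0 ?(C0 (a, b))// ltW.
Qed.

Lemma transported_ge0 (a b : V) : 0 <= transported a b.
Proof.
have [K0 _] := K_markov (val a).
by rewrite !addr_ge0 ?mulr_ge0 ?boundary_ge0 ?exterior_ge0.
Qed.

(** Pairs [(x, y)] are split by membership in [Om]: inside there is equality, the two crossing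
    families are equal and give the factor 2, and outside the coupling bound applies. *)
Lemma dirichlet_extension_le (f : V -> R) :
  dirichlet K mu (extension P f)
    <= 2^-1 * \sum_a \sum_b transported a b * (f a - f b) ^+ 2.
Proof.
rewrite /dirichlet ler_pM2l ?invr_gt0//.
set g := extension P f.
under eq_bigr => x _ do under eq_bigr => y _ do rewrite real_normK ?num_real//.
pose G x y := (g x - g y) ^+ 2 * K x y * mu x.
have GC x y : G x y = G y x.
  have := K_rev x y; rewrite /G => e.
  by rewrite -mulrA [K x y * _]mulrC e; ring.
have Om_ext (h : T -> T -> R) x : \sum_(y : T) h x y =
    \sum_(b : V) h x (val b) + \sum_(y | y \notin Om) h x y.
  by rewrite (bigID (mem Om))/= big_sub.
rewrite (bigID (mem Om))/= big_sub.
have -> : \sum_(x : V) \sum_y (g (val x) - g y) ^+ 2 * K (val x) y * mu (val x)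
  = \sum_a \sum_b K (val a) (val b) * mu (val a) * (f a - f b) ^+ 2
    + \sum_(a : V) \sum_(y | y \notin Om) G (val a) y.
  rewrite -big_split/=; apply: eq_bigr => a _.
  rewrite (Om_ext G); congr (_ + _).
  by apply: eq_bigr => b _; rewrite /G /g !extension_val -mulrA mulrC.
(* Reversibility, through [GC], turns transitions entering [Om] into transitions leaving it. *)
have -> : \sum_(x | x \notin Om) \sum_y (g x - g y) ^+ 2 * K x y * mu x
  = \sum_(a : V) \sum_(y | y \notin Om) G (val a) y
    + \sum_(x | x \notin Om) \sum_(y | y \notin Om) G x y.
  under eq_bigr do rewrite (Om_ext G).
  rewrite big_split/= exchange_big/=; congr (_ + _).
  by apply: eq_bigr => a _; apply: eq_bigr => y _; rewrite GC.
have bd : \sum_(a : V) \sum_(y | y \notin Om) G (val a) y <=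
    \sum_a \sum_b
      (\sum_(y | y \notin Om) P y b * K (val a) y * mu (val a)) * (f a - f b) ^+ 2.
  apply: ler_sum => a _; have [K0 _] := K_markov (val a).
  under [leRHS]eq_bigr do rewrite big_distrl/=.
  rewrite exchange_big/=; apply: ler_sum => y _.
  rewrite /G /g extension_val.
  have := sqr_extension_le f a y.
  move=> /(ler_wpM2r (mulr_ge0 (K0 y) (mu_ge0 (val a)))).
  rewrite mulrA => /le_trans -> //; rewrite big_distrl/=.
  by apply: ler_sum => b _; rewrite le_eqVlt; apply/orP; left; apply/eqP; ring.
have ext : \sum_(x | x \notin Om) \sum_(y | y \notin Om) G x y <=
    \sum_a \sum_b
      (\sum_(xy : T * T | [&& 0 < K xy.1 xy.2, xy.1 \notin Om & xy.2 \notin Om])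
         C xy.1 xy.2 a b * K xy.1 xy.2 * mu xy.1) * (f a - f b) ^+ 2.
  under [leRHS]eq_bigr do under eq_bigr do rewrite big_distrl/=.
  under [leRHS]eq_bigr do rewrite exchange_big/=.
  rewrite [leRHS]exchange_big/= [leLHS]pair_big/=.
  (* Couplings are given only where [K] is positive; the other pairs contribute zero. *)
  rewrite [leLHS](bigID (fun xy => 0 < K xy.1 xy.2))/=.
  rewrite [X in _ + X]big1 ?addr0; last first.
    move=> [x y] /= /andP[_]; have [K0 _] := K_markov x.
    rewrite lt_neqAle K0 andbT negbK => /eqP K_0.
    by rewrite /G -K_0 mulr0 mul0r.
  under eq_bigl do rewrite andbC.
  apply: ler_sum => -[x y] /= /and3P[Kxy _ _].
  have := sqr_coupling_le f (C_coupling Kxy).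
  move=> /(ler_wpM2r (mulr_ge0 (ltW Kxy) (mu_ge0 x))).
  rewrite /G mulrA => /le_trans -> //; rewrite big_distrl/=.
  apply: ler_sum => a _; rewrite big_distrl/=.
  by apply: ler_sum => b _; rewrite le_eqVlt; apply/orP; left; apply/eqP; ring.
have -> : \sum_a \sum_b transported a b * (f a - f b) ^+ 2 =
    \sum_a \sum_b K (val a) (val b) * mu (val a) * (f a - f b) ^+ 2
    + 2 * \sum_a \sum_b
      (\sum_(y | y \notin Om) P y b * K (val a) y * mu (val a)) * (f a - f b) ^+ 2
    + \sum_a \sum_b
      (\sum_(xy : T * T | [&& 0 < K xy.1 xy.2, xy.1 \notin Om & xy.2 \notin Om])
         C xy.1 xy.2 a b * K xy.1 xy.2 * mu xy.1) * (f a - f b) ^+ 2.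
  rewrite big_distrr/= -!big_split/=; apply: eq_bigr => a _.
  rewrite big_distrr/= -!big_split/=; apply: eq_bigr => b _.
  by rewrite /transported; ring.
move: bd ext; lra.
Qed.

End DirichletExtension.

(** * Averaging over the flow and exchanging sums *)

Section Flow.
Variables (R : realType) (V : finType) (Q : V -> V -> R).

(** As an intersection with the set of all paths, the sum for each edge becomes a conditional sum
    over one common index set, ready for the exchange. *)
Lemma paths_throughE (q r : V) : paths_through Q q r =
  [set g | is_path Q g] `&` [set g | (q, r) \in zip (g.1 :: g.2) g.2].
Proof.
apply/seteqP; split=> [[x s]|[x s]] [gp] /=.
  (* Entry [i] of the zip consists of vertices [i] and [i.+1]; the default [x] agrees with that of
     [path_vertex]. *)
  move=> [i [ilt <- <-]]; split=> //=; apply/(nthP (x, x)); exists i.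
    by rewrite size_zip_path.
  rewrite nth_zip_cond size_zip_path ilt; congr (_, _).
move=> /(nthP (x, x))[i]; rewrite size_zip_path => ilt.
by rewrite nth_zip_cond size_zip_path ilt => -[<- <-]; split=> //; exists i.
Qed.

Variables (F : vseq V -> R) (W : V -> V -> R) (f : V -> R).
Hypothesis F_flow : is_flow Q F.
Hypothesis W_ge0 : forall a b, 0 <= W a b.

Local Notation Wpath g := (W (path_init g) (path_final g)).

(** The flow has total mass 1 on the paths from [a] to [b], so it spreads [w a b] over them; every
    path has exactly one pair of endpoints, so these sums combine into one over all paths. *)
Lemma flow_average (w : V -> V -> R) : (forall a b, 0 <= w a b) ->
  (\sum_(p : V * V) w p.1 p.2)%:E =
  (\esum_(g in [set g | is_path Q g])
     (F g * w (path_init g) (path_final g))%:E)%E.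
Proof.
have [F01 F1] := F_flow => w0.
transitivity (\sum_(p : V * V) \esum_(g in [set g | is_path Q g])
    if (path_init g, path_final g) == p then (F g * w p.1 p.2)%:E else 0)%E.
  rewrite -sumEFin; apply: eq_bigr => -[a b] _ /=.
  rewrite -[LHS]mule1 -(F1 a b) -ge0_esumZl//; last first.
    by move=> g [/F01/andP[F0 _] _ _]; rewrite lee_fin.
  have -> : paths_between Q a b = [set g | is_path Q g] `&`
      [set g | (path_init g, path_final g) = (a, b)].
    by apply/seteqP; split=> g /= [gp]; [move=> -> ->|case].
  rewrite esum_mkcondr; apply: eq_esum => g _.
  have -> : (g \in [set g | (path_init g, path_final g) = (a, b)])
      = ((path_init g, path_final g) == (a, b)).
    by apply/idP/eqP; rewrite inE.
  by rewrite -EFinM mulrC.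
rewrite -esum_sum; last first.
  by move=> g p /F01/andP[F0 _] _; case: ifP => // _; rewrite lee_fin mulr_ge0.
apply: eq_esum => g _.
by rewrite -big_mkcond/= (eq_bigl (pred1 (path_init g, path_final g))) ?big_pred1_eq.
Qed.

Lemma flow_comparison :
  ((\sum_a \sum_b W a b * (f a - f b) ^+ 2)%:E <=
   \sum_(qr : V * V | (0 < Q qr.1 qr.2)%R) ((f qr.1 - f qr.2) ^+ 2)%:E *
     \esum_(g in paths_through Q qr.1 qr.2)
       (F g * (path_length g)%:R * Wpath g)%:E)%E.
Proof.
have [F01 _] := F_flow.
rewrite pair_big/= (@flow_average (fun a b => W a b * (f a - f b) ^+ 2)); last first.
  by move=> a b; rewrite mulr_ge0// sqr_ge0.
have FkW0 g : is_path Q g -> 0 <= F g * (path_length g)%:R * Wpath g.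
  by move=> /F01/andP[F0 _]; rewrite !mulr_ge0.
under [leRHS]eq_bigr => qr _.
  rewrite -ge0_esumZl ?sqr_ge0//; last first.
    by move=> g; rewrite paths_throughE => -[/FkW0]; rewrite lee_fin.
  rewrite paths_throughE esum_mkcondr; over.
(* Nonnegativity lets the finite sum over edges pass inside the sum over paths, leaving one
   inequality per path. *)
rewrite -esum_sum; last first.
  move=> g qr /FkW0 g0 _; case: ifP => // _.
  by rewrite -EFinM lee_fin mulr_ge0// sqr_ge0.
apply: le_esum => -[x s] gp /=.
have [F0 _] := andP (F01 _ gp).
pose A := [pred qr : V * V | (0 < Q qr.1 qr.2) && (qr \in zip (x :: s) s)].
have sA : {subset zip (x :: s) s <= A}.
  move=> qr qrs; rewrite inE qrs andbT.
  by move: gp; rewrite /is_path/= path_zip => /allP/(_ _ qrs).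
rewrite -big_mkcondr/= (eq_bigl A); last first.
  by move=> [q r]; congr (_ && _); apply/idP/idP; rewrite inE.
under eq_bigr do rewrite -EFinM.
rewrite sumEFin lee_fin -big_distrl/= [leRHS]mulrC -!mulrA.
rewrite ler_wpM2l//= [leRHS]mulrCA ler_wpM2l//.
exact: sqr_path_le.
Qed.

End Flow.

(** * Assembly: edge-by-edge comparison with the congestion *)

Theorem theorem4 (R : realType) (T : finType) (Om : {set T})
  (K : T -> T -> R) (mu : T -> R)
  (Q : {x : T | x \in Om} -> {x : T | x \in Om} -> R)
  (nu : {x : T | x \in Om} -> R)
  (K_markov : markov_kernel K) (K_lazy : half_lazy K)
  (K_stationary : stationary K mu) (K_ergodic : ergodic K mu)
  (K_irreducible : irreducible K) (K_reversible : reversible K mu)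
  (Q_markov : markov_kernel Q) (Q_lazy : half_lazy Q)
  (Q_stationary : stationary Q nu) (Q_ergodic : ergodic Q nu)
  (Q_irreducible : irreducible Q) (Q_reversible : reversible Q nu)
  (P : T -> {x : T | x \in Om} -> R)
  (P_prob : forall x : T, prob_measure (P x))
  (P_delta : forall x y : {x : T | x \in Om}, P (val x) y = (y == x)%:R)
  (C : T -> T -> {x : T | x \in Om} -> {x : T | x \in Om} -> R)
  (C_coupling : forall x y : T, 0 < K x y -> coupling (P x) (P y) (C x y))
  (F : vseq {x : T | x \in Om} -> R) (F_flow : is_flow Q F)
  (f : {x : T | x \in Om} -> R) :
  ((dirichlet K mu (extension P f))%:E
     <= comparison_const K mu Q nu P C F * (dirichlet Q nu f)%:E)%E.
Proof.
have mu0 : forall x, 0 <= mu x by have [[]] := K_stationary.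
have nu0 := stationary_gt0 Q_markov Q_irreducible Q_stationary.
have [F01 _] := F_flow.
set W := transported K mu P C.
have W0 a b : 0 <= W a b by exact: transported_ge0.
(* The three sums of the congestion have nonnegative terms, so they merge into one sum weighted by
   [W]. *)
have congE q r : congestion K mu Q nu P C F q r = (((Q q r * nu q)^-1)%:E *
    \esum_(g in paths_through Q q r) (F g * (path_length g)%:R
      * W (path_init g) (path_final g))%:E)%E.
  have through0 g : paths_through Q q r g -> 0 <= F g.
    by case=> /F01/andP[].
  rewrite /congestion; congr (_ * _)%E.
  rewrite -ge0_esumZl//; last first.
    by move=> g /through0 F0; rewrite lee_fin !mulr_ge0// boundary_ge0.
  have term1 g : paths_through Q q r g -> 0 <= F g * (path_length g)%:R
      * K (val (path_init g)) (val (path_final g)) * mu (val (path_init g)).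
    by move=> /through0 F0; rewrite !mulr_ge0//; case: (K_markov (val (path_init g))).
  have term2 g : paths_through Q q r g -> 0 <= 2 * ((path_length g)%:R * F g
      * \sum_(y | y \notin Om) P y (path_final g) * K (val (path_init g)) y
          * mu (val (path_init g))).
    by move=> /through0 F0; rewrite !mulr_ge0// boundary_ge0.
  rewrite -!esumD.
  - apply: eq_esum => g _; rewrite -EFinM -!EFinD; congr EFin.
    by rewrite /W /transported; ring.
  - by move=> g g_; rewrite -EFinM -EFinD lee_fin addr_ge0 ?term1 ?term2.
  - by move=> g /through0 F0; rewrite lee_fin !mulr_ge0// (exterior_ge0 mu0 C_coupling).
  - by move=> g /term1; rewrite lee_fin.
  - by move=> g /term2; rewrite -EFinM lee_fin.
set A := comparison_const K mu Q nu P C F.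
have throughA q r : 0 < Q q r ->
    (\esum_(g in paths_through Q q r) (F g * (path_length g)%:R
      * W (path_init g) (path_final g))%:E <= (Q q r * nu q)%:E * A)%E.
  move=> Qqr; rewrite -lee_pdivrMl ?mulr_gt0// -congE.
  by apply: ereal_sup_ubound; exists (q, r).
(* Pairs with [Q] zero drop out, leaving the edges over which the supremum [A] is taken. *)
have -> : dirichlet Q nu f = \sum_(qr | 0 < Q qr.1 qr.2)
    2^-1 * ((f qr.1 - f qr.2) ^+ 2 * (Q qr.1 qr.2 * nu qr.1)).
  rewrite /dirichlet pair_big/= big_distrr/= (bigID (fun qr => 0 < Q qr.1 qr.2))/=.
  rewrite [X in _ + X]big1 ?addr0; last first.
    move=> [q r] /=; have [Q0 _] := Q_markov q.
    by rewrite lt_neqAle Q0 andbT negbK => /eqP <-; rewrite mulr0 mul0r mulr0.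
  by apply: eq_bigr => -[q r] _ /=; rewrite real_normK ?num_real// mulrA.
have := dirichlet_extension_le P_prob P_delta K_markov K_reversible mu0 C_coupling f.
rewrite -lee_fin => /le_trans; apply.
have half0 : (0 <= (2^-1 : R)%:E)%E by rewrite lee_fin invr_ge0.
rewrite EFinM; apply: le_trans (lee_wpmul2l half0 (flow_comparison f F_flow W0)) _.
(* Since [A] may be infinite, distributing it over the sum relies on the terms being nonnegative. *)
rewrite [leRHS]muleC -[X in (_ <= X * _)%E]sumEFin [leRHS]ge0_sume_distrl; last first.
  move=> qr Qqr; rewrite lee_fin mulr_ge0 ?invr_ge0// mulr_ge0 ?sqr_ge0//.
  by rewrite ltW// mulr_gt0.
rewrite [leLHS]ge0_sume_distrr; last first.
  move=> qr _; rewrite mule_ge0 ?lee_fin ?sqr_ge0//.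
  apply: esum_ge0 => g [/F01/andP[F0 _] _].
  by rewrite lee_fin !mulr_ge0.
apply: lee_sum => -[q r] /= Qqr.
rewrite [in leRHS]EFinM -muleA lee_wpmul2l// [in leRHS]EFinM -muleA.
by rewrite lee_wpmul2l ?lee_fin ?sqr_ge0// throughA.
Qed.
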